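(* Let $U\subset\mathbb{R}^N$ be a neighborhood of the origin, let $d$ be a continuous quasimetric on $U$, and let the quasimetric $\widehat d$ on $\mathbb{R}^N$ be its $\delta_\varepsilon$-homogeneous approximation. Let $\Phi:U\to\mathbb{R}^N$ be a homeomorphism (onto its image) on a neighborhood of the origin such that there is a $\delta_\varepsilon$-homogeneous homeomorphism $L:\mathbb{R}^N\to\mathbb{R}^N$ with $$L(x)=\lim_{\varepsilon\to0}\delta_\varepsilon^{-1}\circ\Phi\circ\delta_\varepsilon(x)$$ uniformly in $x\in\mathrm{Box}(r_0)$ for some $r_0>0$. Consider the quasimetric space $(\Phi^{-1}(U),\rho)$, where $\rho(u,v)=d(\Phi(u),\Phi(v))$. Then: 1. There is a limit $$\widehat\rho(u,v):=\lim_{\varepsilon\to0}\frac1\varepsilon\,\rho(\delta_\varepsilon u,\delta_\varepsilon v)$$ for all $u,v\in\mathbb{R}^N$, uniform in a neighborhood of the origin $V\subset\Phi^{-1}(U)$. 2. $\widehat\rho$ is a continuous $\delta_\varepsilon$-homogeneous quasimetric on $\mathbb{R}^N$. 3. The map $L$ is a $\delta_\varepsilon$-homogeneous isometry of the quasimetric spaces $(\mathbb{R}^N,\widehat d)$ and $(\mathbb{R}^N,\widehat\rho)$, i.e. $\delta_\varepsilon L(x)=L(\delta_\varepsilon x)$ and $\widehat\rho(x,y)=\widehat d(L(x),L(y))$ for all $x,y\in\mathbb{R}^N$ and $\varepsilon>0$.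
   Context: A quasimetric on a neighborhood $U\subset\mathbb{R}^N$ of the origin is a continuous function $d:U\times U\to\mathbb{R}$ such that: $d(x,y)\ge 0$, with $d(x,y)=0$ iff $x=y$; $d(x,y)\le C\,d(y,x)$ for all $x,y\in U$ and some constant $C\ge1$; $d(x,z)\le Q(d(x,y)+d(y,z))$ for all $x,y,z\in U$ and some constant $Q\ge1$. The pair $(U,d)$ is called a quasimetric space. Fix a tuple $(\sigma_1,\dots,\sigma_N)$ of positive real numbers. For $\varepsilon>0$ set $\delta_\varepsilon(x_1,\dots,x_N)=(\varepsilon^{\sigma_1}x_1,\dots,\varepsilon^{\sigma_N}x_N)$. Set $\|x\|=\max_{k}|x_k|^{1/\sigma_k}$ and $\mathrm{Box}(r)=\{x\in\mathbb{R}^N:\|x\|<r\}$. A map $L:\mathbb{R}^N\to\mathbb{R}^N$ is $\delta_\varepsilon$-homogeneous if $L\circ\delta_\varepsilon=\delta_\varepsilon\circ L$ for all $\varepsilon>0$. A quasimetric $\widehat d$ on $\mathbb{R}^N$ is $\delta_\varepsilon$-homogeneous if $\widehat d(\delta_\varepsilon x,\delta_\varepsilon y)=\varepsilon\,\widehat d(x,y)$ for all $x,y\in\mathbb{R}^N$, $\varepsilon>0$. A $\delta_\varepsilon$-homogeneous quasimetric $\widehat d$ is the $\delta_\varepsilon$-homogeneous approximation of $d$ if $\lim_{\varepsilon\to0}\frac1\varepsilon d(\delta_\varepsilon x,\delta_\varepsilon y)=\widehat d(x,y)$ uniformly for $x,y$ in some neighborhood of the origin. $\Phi^{-1}(U)$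 denotes the preimage $\{x\in U:\Phi(x)\in U\}$. *)

(* Defs.v *)
From HB Require Import structures.
From mathcomp Require Import all_boot all_order all_algebra.
From mathcomp Require Import all_classical all_reals all_analysis.
Set Implicit Arguments.
Unset Strict Implicit.
Unset Printing Implicit Defensive.
Import Order.TTheory GRing.Theory Num.Theory.
Import numFieldNormedType.Exports.
Local Open Scope classical_set_scope.
Local Open Scope ring_scope.

(* Maps defined on a subset U of R^N are represented by total functions whose
   values outside U are never constrained by the definitions below. *)

Definition is_quasimetric (R : realType) (N : nat) (U : set 'rV[R]_N)
    (d : 'rV[R]_N -> 'rV[R]_N -> R) : Prop :=
  [/\ {within U `*` U, continuous (fun p : 'rV[R]_N * 'rV[R]_N => d p.1 p.2)},
      (forall x y, U x -> U y -> 0 <= d x y),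
      (forall x y, U x -> U y -> (d x y = 0 <-> x = y)),
      (exists2 C : R, 1 <= C &
        forall x y, U x -> U y -> d x y <= C * d y x) &
      (exists2 Q : R, 1 <= Q &
        forall x y z, U x -> U y -> U z -> d x z <= Q * (d x y + d y z))].

Definition dil (R : realType) (N : nat) (sigma : 'I_N -> R) (e : R)
    (x : 'rV[R]_N) : 'rV[R]_N :=
  \row_k (e `^ sigma k * x ord0 k).

(* For e > 0 the inverse of [dil sigma e] is [dil sigma e^-1]. *)
Lemma dilK (R : realType) (N : nat) (sigma : 'I_N -> R) (e : R) :
  0 < e -> cancel (dil sigma e) (dil sigma e^-1).
Proof.
move=> e0 x; apply/rowP => k; rewrite !mxE mulrA -powRM ?invr_ge0 ?ltW//.
by rewrite mulVf ?gt_eqF// powR1 mul1r.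
Qed.

Lemma dilVK (R : realType) (N : nat) (sigma : 'I_N -> R) (e : R) :
  0 < e -> cancel (dil sigma e^-1) (dil sigma e).
Proof. by move=> e0 x; rewrite -{1}(invrK e) dilK// invr_gt0. Qed.

Definition homnorm (R : realType) (N : nat) (sigma : 'I_N -> R)
    (x : 'rV[R]_N) : R :=
  \big[Num.max/0]_(k < N) (`|x ord0 k| `^ (sigma k)^-1).

Definition Box (R : realType) (N : nat) (sigma : 'I_N -> R) (r : R) :
    set 'rV[R]_N :=
  [set x | homnorm sigma x < r].

Definition homogeneous_map (R : realType) (N : nat) (sigma : 'I_N -> R)
    (L : 'rV[R]_N -> 'rV[R]_N) : Prop :=
  forall e : R, 0 < e -> forall x, L (dil sigma e x) = dil sigma e (L x).

Definition homogeneous_dist (R : realType) (N : nat) (sigma : 'I_N -> R)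
    (d : 'rV[R]_N -> 'rV[R]_N -> R) : Prop :=
  forall e : R, 0 < e ->
    forall x y, d (dil sigma e x) (dil sigma e y) = e * d x y.

Definition rescaled (R : realType) (N : nat) (sigma : 'I_N -> R)
    (d : 'rV[R]_N -> 'rV[R]_N -> R) (e : R) (p : 'rV[R]_N * 'rV[R]_N) : R :=
  e^-1 * d (dil sigma e p.1) (dil sigma e p.2).

Definition uniform_rescaled_limit (R : realType) (N : nat)
    (sigma : 'I_N -> R) (d dhat : 'rV[R]_N -> 'rV[R]_N -> R)
    (W : set 'rV[R]_N) : Prop :=
  {uniform W `*` W, rescaled sigma d e @[e --> 0^'+] -->
     (fun p : 'rV[R]_N * 'rV[R]_N => dhat p.1 p.2)}.

(* If [d] is only meaningful on a neighborhood of the origin, then W may be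
   shrunk to a bounded set, whose dilates eventually lie in the domain. *)
Definition homogeneous_approximation (R : realType) (N : nat)
    (sigma : 'I_N -> R) (d dhat : 'rV[R]_N -> 'rV[R]_N -> R) : Prop :=
  [/\ is_quasimetric setT dhat,
      homogeneous_dist sigma dhat &
      exists2 W : set 'rV[R]_N, nbhs (0 : 'rV[R]_N) W &
        uniform_rescaled_limit sigma d dhat W].

Definition homeomorphism_onto_image (R : realType) (N : nat)
    (A : set 'rV[R]_N) (f : 'rV[R]_N -> 'rV[R]_N) : Prop :=
  {within A, continuous f} /\
  exists g : 'rV[R]_N -> 'rV[R]_N,
    (forall x, A x -> g (f x) = x) /\ {within f @` A, continuous g}.

Definition homeomorphism (R : realType) (N : nat)
    (f : 'rV[R]_N -> 'rV[R]_N) : Prop :=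
  continuous f /\
  exists g : 'rV[R]_N -> 'rV[R]_N, [/\ cancel f g, cancel g f & continuous g].

(* Main.v *)
Require Import Defs.
From HB Require Import structures.
From mathcomp Require Import all_boot all_order all_algebra.
From mathcomp Require Import all_classical all_reals all_analysis.
Import Order.TTheory GRing.Theory Num.Theory.
Import numFieldNormedType.Exports.
Local Open Scope classical_set_scope.
Local Open Scope ring_scope.

(** Write Phi_e for the conjugate of Phi by the dilation of ratio e, so that
    rho rescaled by e is d rescaled by e evaluated at (Phi_e u, Phi_e v). A
    uniform limit with a continuous limit function is a joint limit in the
    parameter and the point, and joint limits compose; hence the rescaled rho
    converges jointly to dhat (L u) (L v) at every pair (u, v) close to the
    origin. Joint convergence at all points of a compact neighborhood gives
    uniform convergence on it, and homogeneity carries the pointwise limit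
    from there to all of R^N. *)

(** * Uniform and joint convergence *)

Lemma within_continuous_comp_sub (S T W : topologicalType) (A : set S)
    (B : set T) (f : S -> T) (g : T -> W) :
  (forall x, A x -> B (f x)) -> {within A, continuous f} ->
  {within B, continuous g} -> {within A, continuous (g \o f)}.
Proof.
move=> AB /subspace_continuousP cf /subspace_continuousP cg.
apply/subspace_continuousP => x Ax.
apply: cvg_comp (cg _ (AB _ Ax)) => P /(cf _ Ax).
by rewrite /nbhs/= /within/=; apply: filterS => y Py /[dup] /Py + /AB; apply.
Qed.

(** Go from [f x] to [f y] by continuity and from [f y] to [g i y] by uniformity. The second move is
    allowed for all [y] near [x] because [A] is a neighborhood of [x]. *)
Lemma uniform_cvg_joint (I : Type) (F : set_system I) (T : topologicalType)
    (V : uniformType) (A : set T) (g : I -> T -> V) (f : T -> V) (x : T) :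
  Filter F -> nbhs x A -> {for x, continuous f} ->
  {uniform A, g @ F --> f} ->
  (fun z => g z.1 z.2) @ filter_prod F (nbhs x) --> f x.
Proof.
move=> FF Ax /cvg_app_entourageP cf gf; apply/cvg_app_entourageP => E entE.
have Fg : F [set i | forall y, A y -> split_ent E (f y, g i y)].
  apply: (gf [set h | forall y, A y -> split_ent E (f y, h y)]).
  by apply/uniform_nbhs; exists (split_ent E); split.
exists ([set i | forall y, A y -> split_ent E (f y, g i y)],
        A `&` [set y | split_ent E (f x, f y)]).
  by split=> //=; apply: filterI => //; exact: cf.
by move=> [i y] /= [gi [Ay fy]]; apply: entourage_split fy (gi _ Ay).
Qed.

(** Each point of [K] has a neighborhood on which one set of parameters gives the estimate;
    compactness, in its near-covering form, yields parameters good for all of [K]. *)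
Lemma joint_cvg_uniform (I : Type) (F : set_system I) (T : topologicalType)
    (V : uniformType) (K : set T) (g : I -> T -> V) (f : T -> V) :
  Filter F -> compact K -> (forall x, K x -> {for x, continuous f}) ->
  (forall x, K x -> (fun z => g z.1 z.2) @ filter_prod F (nbhs x) --> f x) ->
  {uniform K, g @ F --> f}.
Proof.
move=> FF cK cf gf P /uniform_nbhs[E [entE sEP]].
have cvK : near_covering K by apply/compact_near_coveringP.
suff : \near F, K `<=` (fun y => E (f y, g F y)).
  by apply: filterS => i Ki; apply: sEP.
apply: cvK => x Kx.
have /cvg_app_entourageP/(_ _ (entourage_split_ent entE)) := gf x Kx.
move=> [[P1 P2] /= [P1F P2x]] sP.
have /cvg_app_entourageP/(_ _ (entourage_inv (entourage_split_ent entE))) :=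
  cf x Kx.
move=> fx; exists ([set y | P2 y /\ split_ent E (f y, f x)], P1).
  by split=> //; apply: filterI.
by move=> [y i] /= [[P2y fy] P1i]; apply: entourage_split fy (sP (i, y) _).
Qed.

(** * Dilations and their contraction to the origin *)

Lemma dilM (R : realType) (N : nat) (sigma : 'I_N -> R) (a b : R)
    (x : 'rV[R]_N) :
  0 <= a -> 0 <= b -> dil sigma (a * b) x = dil sigma a (dil sigma b x).
Proof. by move=> a0 b0; apply/rowP => k; rewrite !mxE powRM// mulrA. Qed.

Lemma dil0 (R : realType) (N : nat) (sigma : 'I_N -> R) (e : R) :
  dil sigma e 0 = 0.
Proof. by apply/rowP => k; rewrite !mxE mulr0. Qed.

Section Dilations.
Context {R : realType} {N : nat} {sigma : 'I_N -> R}.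
Hypothesis sigma_gt0 : forall k, 0 < sigma k.

Lemma cvg_dil0 {y : R -> 'rV[R]_N} {y0 : 'rV[R]_N} :
  y @ 0^'+ --> y0 -> dil sigma e (y e) @[e --> 0^'+] --> (0 : 'rV[R]_N).
Proof.
move=> yy0 P [Q Q0 sQP]; apply: filterS sQP _.
have /= : \forall e \near 0^'+, forall k : 'I_N,
    Q ord0 k (dil sigma e (y e) ord0 k).
  apply: filter_forall => k; have := Q0 ord0 k; rewrite mxE.
  have : e `^ sigma k * y e ord0 k @[e --> 0^'+] --> 0 * y0 ord0 k.
    apply: cvgM; first exact: powR_cvg0.
    exact: (cvg_comp _ _ yy0 (@coord_continuous _ _ _ ord0 k y0)).
  rewrite mul0r => /[apply]; rewrite /nbhs /=; apply: filterS => e.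
  by rewrite mxE.
by apply: filterS => e Qe i k; rewrite ord1.
Qed.

Lemma dil_absorb (V : set 'rV[R]_N) (u v : 'rV[R]_N) :
  nbhs (0 : 'rV[R]_N) V ->
  exists l : R, [/\ 0 < l, V (dil sigma l u) & V (dil sigma l v)].
Proof.
move=> V0.
have Vx x : \forall e \near 0^'+, V (dil sigma e x).
  exact: (cvg_dil0 (cvg_cst x)).
near (0 : R)^'+ => l; exists l; split.
- by near: l; exact: nbhs_right_gt.
- by near: l; exact: Vx.
- by near: l; exact: Vx.
Unshelve. all: by end_near. Qed.

(** The origin is fixed by every dilation, hence so is its image, while dilations contract every
    point to 0. *)
Lemma homogeneous_map0 (L : 'rV[R]_N -> 'rV[R]_N) :
  homogeneous_map sigma L -> L 0 = 0.
Proof.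
move=> Lh; have L00 : dil sigma e (L 0) @[e --> 0^'+] --> (0 : 'rV[R]_N).
  exact: (cvg_dil0 (cvg_cst _)).
suff : dil sigma e (L 0) @[e --> 0^'+] --> L 0.
  by move/(cvg_unique (@norm_hausdorff _ _)); apply.
apply: cvg_near_cst; near=> e.
by rewrite -Lh ?dil0//; near: e; exact: nbhs_right_gt.
Unshelve. all: by end_near. Qed.

(** Dilating the convergent family back by [e] gives a family that tends to 0 and is constantly
    [x]. *)
Lemma dil_limit_eq0 (x y : 'rV[R]_N) :
  dil sigma e^-1 x @[e --> 0^'+] --> y -> x = 0.
Proof.
move=> /cvg_dil0 x0.
suff : dil sigma e (dil sigma e^-1 x) @[e --> 0^'+] --> x.
  by move/(cvg_unique (@norm_hausdorff _ _)); apply.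
by apply: cvg_near_cst; near=> e; rewrite dilVK.
Unshelve. all: by end_near. Qed.

Lemma nbhs_Box (r : R) : 0 < r -> nbhs (0 : 'rV[R]_N) (Box sigma r).
Proof.
move=> r0; exists (fun _ k => ball (0 : R) (r `^ sigma k)) => [i k|x xr].
  by rewrite mxE; apply: nbhsx_ballx; rewrite powR_gt0.
rewrite /Box /= /homnorm; apply: bigmax_lt => // k _.
have := xr ord0 k; rewrite /ball/= sub0r normrN => xk.
rewrite -[ltRHS](powRr1 (ltW r0)) -(divff (lt0r_neq0 (sigma_gt0 k))) powRrM.
by apply: gt0_ltr_powR => //; rewrite ?invr_gt0// nnegrE ?powR_ge0.
Qed.

End Dilations.

Lemma compact_nbhs0 (R : realType) (N : nat) (B : set 'rV[R]_N) :
  nbhs (0 : 'rV[R]_N) B ->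
  exists K : set 'rV[R]_N, [/\ nbhs (0 : 'rV[R]_N) K, compact K & K `<=` B].
Proof.
move=> /nbhs_ballP[r /= r0 rB].
(* Halving the radius makes the closed cube fit in the open ball of radius [r]. *)
exists [set v : 'rV[R]_N | forall k, `[- (r / 2), r / 2]%classic (v ord0 k)].
split.
- apply/nbhs_ballP; exists (r / 2); first by rewrite /= divr_gt0.
  move=> v [_ vr] k; have := vr ord0 k.
  by rewrite /ball /= mxE sub0r normrN in_itv/= -ler_norml => /ltW.
- by apply: (@rV_compact R N (fun=> _)) => k; exact: segment_compact.
- move=> v vr; apply: rB; split=> // i k; have := vr k.
  rewrite (ord1 i) /ball /= mxE sub0r normrN in_itv/= -ler_norml => vk.
  by apply: le_lt_trans vk _; rewrite ltr_pdivrMr// ltr_pMr// ltr1n.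
Qed.

(** * Rescaling and pulling back quasimetrics *)

Lemma cvg_rescaled_hom (R : realType) (N : nat) (sigma : 'I_N -> R)
    (d dhat : 'rV[R]_N -> 'rV[R]_N -> R) (l : R) (u v : 'rV[R]_N) :
  homogeneous_dist sigma dhat -> 0 < l ->
  rescaled sigma d e (dil sigma l u, dil sigma l v) @[e --> 0^'+]
    --> dhat (dil sigma l u) (dil sigma l v) ->
  rescaled sigma d e (u, v) @[e --> 0^'+] --> dhat u v.
Proof.
move=> dh l0; rewrite dh// => dl.
(* Substitute [l^-1 * e] for the parameter: the dilation by [l] is absorbed, and what remains is [l]
   times the rescaling of [d] at [(u, v)]. *)
have ml : l^-1 * e @[e --> 0^'+] --> 0^'+.
  have : l^-1 * e @[e --> 0^'+] --> l^-1 * 0.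
    by apply: cvgM; [exact: cvg_cst|exact: cvg_at_right_filter cvg_id].
  rewrite mulr0 => ml P; rewrite /= {1}/at_right /within/= => /ml.
  rewrite /nbhs /= => mP; near=> e; apply: (near mP e) => //.
  by rewrite mulr_gt0 ?invr_gt0.
rewrite -[dhat u v]mul1r -(mulVf (lt0r_neq0 l0)) -mulrA.
apply: cvg_trans (cvgM (cvg_cst l^-1) (cvg_comp _ _ ml dl)).
apply: near_eq_cvg; near=> e.
have e0 : 0 < e by [].
rewrite /rescaled/= -!dilM ?mulr_ge0 ?invr_ge0 ?ltW//.
rewrite mulrAC mulVf ?gt_eqF// mul1r invfM invrK.
by rewrite mulrA mulrA mulVf ?gt_eqF// mul1r.
Unshelve. all: by end_near. Qed.

Lemma quasimetric_continuous (R : realType) (N : nat)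
    (d : 'rV[R]_N -> 'rV[R]_N -> R) :
  is_quasimetric setT d ->
  continuous (fun p : 'rV[R]_N * 'rV[R]_N => d p.1 p.2).
Proof.
move=> [dc _ _ _ _]; rewrite setXTT in dc.
exact: (iffRL (continuous_subspace_setT _) dc).
Qed.

(** Serves twice: for [rho], pulled back along [Phi], and for the limit, pulled back along [L]. *)
Lemma quasimetric_comp (R : realType) (N : nat) (A B : set 'rV[R]_N)
    (d : 'rV[R]_N -> 'rV[R]_N -> R) (f : 'rV[R]_N -> 'rV[R]_N) :
  is_quasimetric B d -> {within A, continuous f} ->
  (forall x, A x -> B (f x)) ->
  (forall x y, A x -> A y -> f x = f y -> x = y) ->
  is_quasimetric A (fun u v => d (f u) (f v)).
Proof.
move=> [dc d0 dE [C C1 dC] [Q Q1 dQ]] /subspace_continuousP fc AB fI; split.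
- apply: (@within_continuous_comp_sub _ _ _ _ (B `*` B)
    (fun p => (f p.1, f p.2)) (fun p => d p.1 p.2)) => //.
    by move=> [x y] /= [Ax Ay]; split; exact: AB.
  apply/subspace_continuousP => -[x y] /= [Ax Ay].
  rewrite /from_subspace /=.
  apply: (@cvg_pair _ _ _ _ (nbhs (f x)) (nbhs (f y)) _ _ _
    (fun p => f p.1) (fun p => f p.2)) => /=.
    apply: cvg_comp (fc _ Ax) => P Px.
    exists ([set z | A z -> P z], setT) => /=.
      by split => //; exact: filterT.
    by move=> z [+ _] [+ _]; apply.
  apply: cvg_comp (fc _ Ay) => P Py.
  exists (setT, [set z | A z -> P z]) => /=.
    by split => //; exact: filterT.
  by move=> z [_ +] [_ +]; apply.
- by move=> x y Ax Ay; apply: d0; exact: AB.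
- move=> x y Ax Ay; split=> [/dE|->]; last by apply/dE => //; exact: AB.
  by move=> fxy; apply: fI => //; apply: fxy; exact: AB.
- by exists C => // x y Ax Ay; apply: dC; exact: AB.
- by exists Q => // x y z Ax Ay Az; apply: dQ; exact: AB.
Qed.

(** * Joint limits at a pair of points *)

Lemma cvg_fst_joint (I : Type) (F : set_system I) (S T W : topologicalType)
  (g : I -> S -> W) (x : S) (y : T) (l : W) :
  Filter F ->
  (fun z => g z.1 z.2) @ filter_prod F (nbhs x) --> l ->
  (fun z => g z.1 z.2.1) @ filter_prod F (nbhs (x, y)) --> l.
Proof.
move=> FF gl P /gl [[P1 P2] /= [P1F P2x] sP].
exists (P1, [set z | P2 z.1]) => /=.
  split=> //; exists (P2, setT) => /=; first by split=> //; exact: filterT.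
  by move=> z [].
by move=> [i z] /= [P1i P2z]; exact: (sP (i, z.1)).
Qed.

Lemma cvg_snd_joint (I : Type) (F : set_system I) (S T W : topologicalType)
  (g : I -> T -> W) (x : S) (y : T) (l : W) :
  Filter F ->
  (fun z => g z.1 z.2) @ filter_prod F (nbhs y) --> l ->
  (fun z => g z.1 z.2.2) @ filter_prod F (nbhs (x, y)) --> l.
Proof.
move=> FF gl P /gl [[P1 P2] /= [P1F P2y] sP].
exists (P1, [set z | P2 z.2]) => /=.
  split=> //; exists (setT, P2) => /=; first by split=> //; exact: filterT.
  by move=> z [].
by move=> [i z] /= [P1i P2z]; exact: (sP (i, z.2)).
Qed.

Lemma rescaled_conj (R : realType) (N : nat) (sigma : 'I_N -> R)
    (d : 'rV[R]_N -> 'rV[R]_N -> R) (f : 'rV[R]_N -> 'rV[R]_N) (e : R)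
    (u v : 'rV[R]_N) : 0 < e ->
  let fe := dil sigma e^-1 \o f \o dil sigma e in
  rescaled sigma d e (fe u, fe v) =
  rescaled sigma (fun x y => d (f x) (f y)) e (u, v).
Proof. by move=> e0; rewrite /rescaled/= !dilVK. Qed.

(** * The limit of the pulled-back quasimetric *)

Theorem theorem5 (R : realType) (N : nat) (sigma : 'I_N -> R)
  (sigma_gt0 : forall k, 0 < sigma k)
  (U : set 'rV[R]_N) (U0 : nbhs (0 : 'rV[R]_N) U)
  (d : 'rV[R]_N -> 'rV[R]_N -> R) (d_qm : is_quasimetric U d)
  (dhat : 'rV[R]_N -> 'rV[R]_N -> R)
  (dhat_approx : homogeneous_approximation sigma d dhat)
  (Phi : 'rV[R]_N -> 'rV[R]_N) (Phi_homeo : homeomorphism_onto_image U Phi)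
  (L : 'rV[R]_N -> 'rV[R]_N) (L_homeo : homeomorphism L)
  (L_hom : homogeneous_map sigma L)
  (r0 : R) (r0_gt0 : 0 < r0)
  (L_lim : {uniform Box sigma r0,
     (dil sigma e^-1 \o Phi \o dil sigma e) @[e --> 0^'+] --> L}) :
  let PhiU : set 'rV[R]_N := U `&` Phi @^-1` U in
  let rho : 'rV[R]_N -> 'rV[R]_N -> R := fun u v => d (Phi u) (Phi v) in
  [/\ nbhs (0 : 'rV[R]_N) PhiU,
      is_quasimetric PhiU rho &
      exists rhohat : 'rV[R]_N -> 'rV[R]_N -> R,
        [/\ (forall u v, rescaled sigma rho e (u, v) @[e --> 0^'+]
                           --> rhohat u v),
            (exists V : set 'rV[R]_N,
               [/\ nbhs (0 : 'rV[R]_N) V, V `<=` PhiU &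
                   uniform_rescaled_limit sigma rho rhohat V]),
            is_quasimetric setT rhohat /\ homogeneous_dist sigma rhohat &
            (forall (e : R) (x : 'rV[R]_N), 0 < e ->
               dil sigma e (L x) = L (dil sigma e x)) /\
            (forall x y, rhohat x y = dhat (L x) (L y))]].
Proof.
move=> PhiU rho.
have [dhat_qm dhat_hom [W W0 d_lim]] := dhat_approx.
have [Phi_cont [Psi [PsiK _]]] := Phi_homeo.
have [L_cont [M [LK MK _]]] := L_homeo.
have L0 := homogeneous_map0 sigma_gt0 _ L_hom.
pose Phie e := dil sigma e^-1 \o Phi \o dil sigma e.
have joint_Phi u : nbhs u (Box sigma r0) ->
    (fun z => Phie z.1 z.2) @ filter_prod 0^'+ (nbhs u) --> L u.
  by move=> Bu; apply: uniform_cvg_joint Bu (L_cont u) L_lim.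
(* At the origin [Phie e 0] is [dil sigma e^-1 (Phi 0)]; such a family can converge only if [Phi 0]
   vanishes. *)
have Phi0 : Phi 0 = 0.
  apply: (dil_limit_eq0 sigma_gt0 _ (L 0)) => P LP.
  have [[P1 P2] /= [P1F P2x] sP] :=
    joint_Phi 0 (nbhs_Box sigma_gt0 r0 r0_gt0) P LP.
  rewrite /nbhs/=; apply: filterS P1F => e P1e.
  by have := sP (e, 0) (conj P1e (nbhs_singleton P2x)); rewrite /= /Phie /= dil0.
have PhiU0 : nbhs (0 : 'rV[R]_N) PhiU.
  have /subspace_continuousP/(_ 0 (nbhs_singleton U0)) := Phi_cont.
  rewrite /from_subspace Phi0 => /(_ U U0) PU.
  by apply: filterS2 U0 PU => x Ux PUx; split => //; exact: PUx.
have rhohat_qm : is_quasimetric setT (fun u v => dhat (L u) (L v)).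
  apply: quasimetric_comp dhat_qm _ _ _ => //; first exact: continuous_subspaceT.
  by move=> x y _ _ /(can_inj LK).
split=> //.
  apply: (quasimetric_comp _ _ PhiU) d_qm _ _ _.
  - by apply: continuous_subspaceW Phi_cont => x [].
  - by move=> x [].
  - by move=> x y [Ux _] [Uy _] Pxy; rewrite -(PsiK x)// -(PsiK y)// Pxy.
have dhat_cont := quasimetric_continuous _ _ _ dhat_qm.
have rhohat_cont := quasimetric_continuous _ _ _ rhohat_qm.
have rhohat_hom : homogeneous_dist sigma (fun u v => dhat (L u) (L v)).
  by move=> e e0 x y; rewrite !L_hom// dhat_hom.
(* Interiors are taken because joint convergence at a point [u] of [K] needs [Box sigma r0] to be a
   neighborhood of [u] and [W] one of [L u]. *)
have /compact_nbhs0[K [K0 cK KB]] : nbhs (0 : 'rV[R]_N)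
    (PhiU `&` (Box sigma r0)^° `&` L @^-1` W^°).
  apply: filterI; first apply: filterI => //.
    by apply: nbhs_interior; exact: nbhs_Box.
  by apply: L_cont; rewrite L0; exact: nbhs_interior.
have joint_rho (p : 'rV[R]_N * 'rV[R]_N) : (K `*` K) p ->
    (fun z => rescaled sigma rho z.1 z.2) @ filter_prod 0^'+ (nbhs p) -->
      dhat (L p.1) (L p.2).
  case: p => u v [/KB[[_ Bu] Wu] /KB[[_ Bv] Wv]].
  have joint_d : (fun z => rescaled sigma d z.1 z.2) @
      filter_prod 0^'+ (nbhs (L u, L v)) --> dhat (L u) (L v).
    apply: uniform_cvg_joint (dhat_cont _) d_lim.
    by exists (W, W).
  (* The parameter is carried along as a first component, so that this limit can be fed into
     [joint_d]. *)
  have : (fun z => (z.1, (Phie z.1 z.2.1, Phie z.1 z.2.2))) @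
      filter_prod 0^'+ (nbhs (u, v)) --> filter_prod 0^'+ (nbhs (L u, L v)).
    apply: (@cvg_pair _ _ _ _ 0^'+ (nbhs (L u, L v)) _ _ _ fst
      (fun z => (Phie z.1 z.2.1, Phie z.1 z.2.2))); first exact: cvg_fst.
    apply: (@cvg_pair _ _ _ _ (nbhs (L u)) (nbhs (L v)) _ _ _
      (fun z => Phie z.1 z.2.1) (fun z => Phie z.1 z.2.2)).
      exact/cvg_fst_joint/joint_Phi.
    exact/cvg_snd_joint/joint_Phi.
  move=> /cvg_comp/(_ joint_d) joint_dPhi.
  (* The two functions agree where [e] is positive, which holds eventually along [0^'+]. *)
  apply: cvg_trans joint_dPhi; apply: near_eq_cvg.
  exists ([set e | 0 < e], setT) => /=.
    by split; [exact: nbhs_right_gt|exact: filterT].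
  by move=> [e [u' v']] /= [e0 _]; rewrite (rescaled_conj _ _ sigma).
exists (fun u v => dhat (L u) (L v)); split=> //.
(* Shrink the pair into [K], take the limit there with the point held fixed, and undo the dilation
   by homogeneity. *)
- move=> u v; have [l [l0 Ku Kv]] := dil_absorb sigma_gt0 K u v K0.
  apply: (cvg_rescaled_hom _ _ _ _ _ l u v rhohat_hom l0).
  pose p := (dil sigma l u, dil sigma l v).
  apply: (cvg_comp (fun e => (e, p)) (fun z => rescaled sigma rho z.1 z.2) _
    (joint_rho p (conj Ku Kv))).
  apply: (@cvg_pair _ _ _ _ 0^'+ (nbhs p) _ _ _ id (fun=> p)).
    exact: cvg_id.
  exact: cvg_cst.
- exists K; split=> //; first by move=> x /KB[[]].
  apply: joint_cvg_uniform joint_rho => //; first exact: compact_setX.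
  by move=> p _; exact: rhohat_cont.
- by split=> // e x e0; rewrite L_hom.
Qed.
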